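(* Let $p,q,Q,m,N_1,\dots,N_m,J,L$ be as in the context, with $L=\{1\}$ (so $1\in J$ and $q-1$ divides $N_1-1$). Let $\Delta=\bigcup_{l=1}^{q-1}\mathfrak{I}_{\boldsymbol{a}_l}$, where $\{\boldsymbol{a}_1,\boldsymbol{a}_2,\dots,\boldsymbol{a}_{q-1}\}$ is a subset of $\mathcal{A}$ such that the first coordinates $a_1,a_2,\dots,a_{q-1}$ of $\boldsymbol{a}_1,\boldsymbol{a}_2,\dots,\boldsymbol{a}_{q-1}$ are pairwise different modulo $q-1$. If there is an index $v$, $1\le v\le q-1$, for which the following conditions hold: (1) $a_v$ divides $N_1-1$, (2) $\gcd(a_v,a_l)=1$ for all $1\le l\le q-1$, $l\ne v$, and (3) $\gcd(a_v,q-1)=1$, then $\mathcal{C}^J_\Delta$ is an LRC code with locality $\le q-1+(a_v-1)$.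
   Context: **Fields and varieties.** Let $p$ be a prime, $q=p^s$, $Q=p^\ell$ with $s\mid \ell$, so $\mathbb{F}_q\subseteq\mathbb{F}_Q$. Let $m\ge1$, $\mathfrak{R}=\mathbb{F}_Q[X_1,\dots,X_m]$, and write $X^{\boldsymbol{a}}=X_1^{a_1}\cdots X_m^{a_m}$. Fix integers $N_j>1$ ($1\le j\le m$) with $N_j-1$ dividing $Q-1$. Let $J\subseteq\{1,\dots,m\}$ and let $I_J\subset\mathfrak{R}$ be the ideal generated by $X_j^{N_j-1}-1$ for $j\in J$ and $X_j^{N_j}-X_j$ for $j\notin J$; $\mathfrak{R}_J=\mathfrak{R}/I_J$. Put $T_j=N_j-2$ if $j\in J$ and $T_j=N_j-1$ otherwise, and $\mathcal{H}_J=\prod_{j=1}^m\{0,1,\dots,T_j\}$. Let $Z_J=\{P_1,\dots,P_{n_J}\}\subset\mathbb{F}_Q^m$ be the zero set of $I_J$, of size $n_J=\prod_{j\notin J}N_j\prod_{j\in J}(N_j-1)$, and $\mathrm{ev}_J:\mathfrak{R}_J\to\mathbb{F}_Q^{n_J}$, $\mathrm{ev}_J(f)=(f(P_1),\dots,f(P_{n_J}))$. **Standing assumption.** $L$ is a fixed non-empty subset of $J$ such that $q-1$ divides $N_j-1$ for all $j\in L$. **Codes.** For non-empty $\Delta\subseteq\mathcal{H}_J$, $E^J_\Delta$ is the $\mathbb{F}_Q$-span of $\{\mathrm{ev}_J(X^{\boldsymbol{a}}):\boldsymbol{a}\in\Delta\}$ in $\mathbb{F}_Q^{n_J}$, and the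 subfield-subcode is $\mathcal{C}^J_\Delta=E^J_\Delta\cap\mathbb{F}_q^{n_J}$, a linear code over $\mathbb{F}_q$. **Cyclotomic sets.** Multiplication by $q$ on $\mathcal{H}_J$ is componentwise: if $j\in J$, $\{0,\dots,T_j\}$ is identified with $\mathbb{Z}/(T_j+1)\mathbb{Z}$; if $j\notin J$, $\{1,\dots,T_j\}$ is identified with $\mathbb{Z}/T_j\mathbb{Z}$ and $q\cdot 0=0$. Minimal cyclotomic sets are the sets $\{q^i\boldsymbol{y}:i\ge0\}$, $\boldsymbol{y}\in\mathcal{H}_J$. The representative of a minimal cyclotomic set is its lexicographically smallest element (minimal first coordinate, then minimal second coordinate among those, etc.). $\mathcal{A}$ is the set of all representatives and $\mathfrak{I}_{\boldsymbol{a}}$ is the minimal cyclotomic set with representative $\boldsymbol{a}\in\mathcal{A}$. **Locality.** Let $\mathcal{C}$ be a linear code of length $n$ over $\mathbb{F}_q$ with generator matrix having columns $\boldsymbol{c}_1,\dots,\boldsymbol{c}_n$. A set $R\subseteq\{1,\dots,n\}$ with $i\notin R$ is a recovery set for coordinate $i$ if $\boldsymbol{c}_i\in\langle\boldsymbol{c}_j:j\in R\rangle$ (independent of the generator matrix; it means that $x_i$ is determined by $(x_j)_{j\in R}$ for every $\boldsymbol{x}\in\mathcal{C}$). The locality of $i$ is the smallest cardinality of a recovery set for $i$. $\mathcal{C}$ is locally recoverable (LRC) if every coordinate has a recovery set; its locality is the largest locality of its coordinates.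
   Formalization: The formal theorem additionally assumes a_v > 1; for a_v = 1 the claim can fail: q=2, Q=4, m=1, J=L={1}, N_1=4, Δ={1,2} gives the [3,2,2] binary code with locality 2 > q-1+(a_v-1) = 1. *)

(* Defs.v *)
From HB Require Import structures.
From mathcomp Require Import all_boot all_order all_algebra all_field.
From mathcomp Require Import mpoly.

Set Implicit Arguments.
Unset Strict Implicit.
Unset Printing Implicit Defensive.

Import GRing.Theory.
Local Open Scope ring_scope.

Section LinearCodes.
Variables (F : finFieldType) (n : nat).
Implicit Types (C : {vspace 'rV[F]_n}) (i : 'I_n) (R : {set 'I_n}).

Definition generator_matrix C : 'M[F]_(\dim C, n) :=
  \matrix_(k < \dim C) (vbasis C)`_k.

Definition recovery_set C i R : bool :=
  (i \notin R) &&
  (col i (generator_matrix C)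
     \in <<[seq col j (generator_matrix C) | j <- enum R]>>%VS).

(* A recovery set has at most n - 1 elements, so the value is n exactly when
   the coordinate i has no recovery set. *)
Definition coord_locality C i : nat :=
  \big[minn/n]_(R : {set 'I_n} | recovery_set C i R) #|R|.

Definition is_LRC C : Prop := forall i, exists R, recovery_set C i R.

Definition locality C : nat := \max_(i < n) coord_locality C i.

Lemma generator_matrixP C (x : 'rV[F]_n) :
  (x \in C) = (x <= generator_matrix C)%MS.
Proof.
rewrite -{1}(span_basis (vbasisP C)); apply/idP/submxP.
  move/coord_span->; exists (\row_k coord (vbasis C) k x).
  rewrite mulmx_sum_row; apply: eq_bigr => k _.
  by rewrite mxE rowK.
case=> D ->; rewrite mulmx_sum_row; apply: memv_suml => k _.
by rewrite rowK memvZ // memv_span // mem_nth // size_tuple.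
Qed.

Lemma span_col_mulmx k1 k2 (U : 'M[F]_(k2, k1)) (G : 'M[F]_(k1, n)) i R :
  col i G \in <<[seq col j G | j <- enum R]>>%VS ->
  col i (U *m G) \in <<[seq col j (U *m G) | j <- enum R]>>%VS.
Proof.
have colU j : col j (U *m G) = linfun (mulmx U) (col j G) by rewrite lfunE /= !colE mulmxA.
move=> hi; rewrite colU.
have -> : [seq col j (U *m G) | j <- enum R]
          = map (linfun (mulmx U)) [seq col j G | j <- enum R].
  by rewrite -map_comp; apply: eq_map => j /=; rewrite colU.
by rewrite -limg_span memv_img.
Qed.

Lemma recovery_set_generator C i R k (G : 'M[F]_(k, n)) :
  (forall x : 'rV_n, (x \in C) = (x <= G)%MS) ->
  recovery_set C i R =
  (i \notin R) && (col i G \in <<[seq col j G | j <- enum R]>>%VS).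
Proof.
move=> hG; rewrite /recovery_set; congr (_ && _).
have /submxP[U eU] : (generator_matrix C <= G)%MS.
  by apply/row_subP => r; rewrite -hG generator_matrixP row_sub.
have /submxP[V eV] : (G <= generator_matrix C)%MS.
  by apply/row_subP => r; rewrite -generator_matrixP hG row_sub.
apply/idP/idP => h; first by rewrite eV; apply: span_col_mulmx.
by rewrite eU; apply: span_col_mulmx.
Qed.

End LinearCodes.

Section SubfieldSubcode.
(* The embedding iota realizes Fq as a subfield of FQ. *)
Variables (Fq FQ : finFieldType) (iota : {rmorphism Fq -> FQ}) (n : nat).
Implicit Type E : {vspace 'rV[FQ]_n}.

Definition subfield_subcode E : {vspace 'rV[Fq]_n} :=
  <<enum [set c : 'rV[Fq]_n | map_mx iota c \in E]>>%VS.

Lemma mem_subfield_subcode E (c : 'rV[Fq]_n) :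
  (c \in subfield_subcode E) = (map_mx iota c \in E).
Proof.
apply/idP/idP => [/coord_span->|hc]; last first.
  by apply: memv_span; rewrite mem_enum inE.
rewrite raddf_sum /=; apply: memv_suml => k _; rewrite map_mxZ memvZ //.
set s := enum _.
have : s`_k \in s by apply: mem_nth; rewrite /s -cardE ltn_ord.
by rewrite mem_enum inE.
Qed.

End SubfieldSubcode.

Section JAffine.
Variables (F : finFieldType) (m : nat) (N : 'I_m -> nat) (J : {set 'I_m}).

Definition J_gen (j : 'I_m) : {mpoly F[m]} :=
  if j \in J then 'X_j ^+ (N j - 1) - 1 else 'X_j ^+ N j - 'X_j.

Definition J_ideal (f : {mpoly F[m]}) : Prop :=
  exists c : 'I_m -> {mpoly F[m]}, f = \sum_(j < m) c j * J_gen j.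

Definition J_zeros : {set {ffun 'I_m -> F}} :=
  [set P : {ffun 'I_m -> F} | [forall j, (J_gen j).@[P] == 0]].

Lemma J_zerosP (P : {ffun 'I_m -> F}) :
  reflect (forall f, J_ideal f -> f.@[P] = 0) (P \in J_zeros).
Proof.
rewrite inE; apply: (iffP forallP) => [h f [c ->]|h j].
  rewrite raddf_sum /= big1 // => j _.
  by rewrite mevalM (eqP (h j)) mulr0.
apply/eqP/h; exists (fun k => (k == j)%:R).
rewrite (bigD1 j) //= eqxx mul1r big1 ?addr0 // => k /negbTE->.
by rewrite mul0r.
Qed.

Definition J_point (i : 'I_#|J_zeros|) : {ffun 'I_m -> F} := enum_val i.

Definition J_ev (f : {mpoly F[m]}) : 'rV[F]_#|J_zeros| :=
  \row_i f.@[J_point i].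

Lemma J_ev_quotient f g : J_ideal (f - g) -> J_ev f = J_ev g.
Proof.
move=> hfg; apply/rowP => i; rewrite !mxE; apply/eqP; rewrite -subr_eq0.
by rewrite -mevalB; apply/eqP; move: hfg; apply/J_zerosP/enum_valP.
Qed.

Definition J_top (j : 'I_m) : nat :=
  if j \in J then (N j - 2)%N else (N j - 1)%N.

Definition J_exps := {dffun forall j : 'I_m, 'I_(J_top j).+1}.

Implicit Types a b y : J_exps.

Definition J_mnm a : 'X_{1..m} := [multinom (a j : nat) | j < m].

Definition affine_code (Delta : {set J_exps}) : {vspace 'rV[F]_#|J_zeros|} :=
  <<[seq J_ev 'X_[J_mnm a] | a <- enum Delta]>>%VS.

Section Cyclotomic.
Variable q : nat.

(* For j outside J a nonzero exponent is a residue modulo J_top j with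
   representatives 1, ..., J_top j, so q * x is sent to
   ((q * x - 1) mod J_top j) + 1. *)
Definition J_mulq_coord (j : 'I_m) (x : nat) : nat :=
  if j \in J then ((q * x) %% (J_top j).+1)%N
  else if x == 0%N then 0%N else ((q * x - 1) %% J_top j).+1.

Definition J_mulq y : J_exps :=
  [ffun j : 'I_m => (inord (J_mulq_coord j (y j)) : 'I_(J_top j).+1)].

Lemma J_mulqE y j : (1 < N j)%N ->
  J_mulq y j = J_mulq_coord j (y j) :> nat.
Proof.
move=> N1; rewrite ffunE inordK // /J_mulq_coord.
case: ifP => jJ; first by rewrite ltn_mod.
case: eqP => [//|_]; rewrite ltnS ltn_mod /J_top jJ.
by rewrite subn_gt0.
Qed.

Definition cyclotomic_set y : {set J_exps} := [set b | fconnect J_mulq y b].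

Definition lex_lt a b : bool :=
  [exists j : 'I_m, (a j < b j)%N &&
     [forall k : 'I_m, (k < j)%N ==> (a k == b k)]].

Definition representatives : {set J_exps} :=
  [set a | [forall b in cyclotomic_set a, (b == a) || lex_lt a b]].

End Cyclotomic.

End JAffine.

(* Main.v *)
(* Multiplying the first coordinate of a point x by r with r ^ (N_1 - 1) = 1
   turns a codeword into g(r) = sum_b c_b r ^ b_1, b in Delta.  Let n = q - 1,
   d = a_v, and let z, w be roots of unity of exact orders n and d.  Exponents
   in the l-th cyclotomic set are congruent to a_l modulo n, and divisible by d
   exactly when l = v, so the v-th part of g is isolated both by a character sum
   over <z> and by an average over any coset of <w>.  Taking the coset z <w>
   gives
     n sum_(j < d) g(w^j z) = d z^d sum_(t < n) z^(- d t) g(z^t),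
   where g(1) occurs only on the right, with coefficient d z^d <> 0, and g(z)
   occurs on both sides.  Hence {z^t : 0 < t < n} and {w^j z : 0 < j < d}
   together recover g(1).  This needs z <> 1; if q = 2 then only the v-th part
   is present, and g(1) = g(w). *)

Require Import Defs.
From HB Require Import structures.
From mathcomp Require Import all_boot all_order all_algebra all_field.
From mathcomp Require Import cyclic mpoly.

Set Implicit Arguments.
Unset Strict Implicit.
Unset Printing Implicit Defensive.

Import GRing.Theory.
Local Open Scope ring_scope.

(** * Separating functionals and recovery sets *)

Lemma vspace_separation (F : fieldType) k (W : {vspace 'cV[F]_k}) (v : 'cV_k) :
  v \notin W ->
  exists u : 'rV_k, (forall w, w \in W -> u *m w = 0) /\ u *m v != 0.
Proof.
(* [f] kills [W] but not [v]; a nonzero coordinate [r] of [f v] yields the functional [u]. *)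
move=> vW; pose f := (\1 - projv W)%VF.
have fE y : f y = y - projv W y by rewrite !lfunE /= !lfunE.
have /cV0Pn[r fvr] : f v != 0.
  by apply: contraNneq vW => /eqP; rewrite fE subr_eq0 => /eqP->; apply: memv_proj.
pose u : 'rV_k := \row_j f (delta_mx j 0) r 0.
have uE y : u *m y = (f y r 0)%:M.
  rewrite [y in RHS]matrix_sum_delta linear_sum /= summxE.
  apply/matrixP => i j; rewrite !ord1 !mxE mulr1n.
  by apply: eq_bigr => t _; rewrite big_ord1 linearZ !mxE mulrC.
exists u; split=> [w wW|]; rewrite uE.
  by rewrite fE projv_id // subrr mxE raddf0.
by apply: contraNneq fvr => /matrixP/(_ 0 0); rewrite !mxE mulr1n => ->.
Qed.

Section Locality.
Variables (F : finFieldType) (n : nat) (C : {vspace 'rV[F]_n}) (i : 'I_n).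

(** If column [i] lay outside the span of the columns in [R], a row [u] separating them would give a
    codeword [u *m G] that vanishes on [R] but not at [i]. *)
Lemma recovery_set_vanishing (R : {set 'I_n}) :
  i \notin R ->
  (forall x, x \in C -> (forall j, j \in R -> x 0 j = 0) -> x 0 i = 0) ->
  recovery_set C i R.
Proof.
move=> iR hR; rewrite /recovery_set iR /=; apply: contraT.
case/vspace_separation=> u [u0 /negP[]]; set G := generator_matrix C.
have uG j : u *m col j G = ((u *m G) 0 j)%:M.
  by apply/matrixP => r s; rewrite !ord1 colE mulmxA -colE !mxE mulr1n.
rewrite uG hR ?raddf0 // => [|j jR]; first by rewrite generator_matrixP submxMl.
have /u0 : col j G \in <<[seq col j G | j <- enum R]>>%VS.
  by apply/memv_span/map_f; rewrite mem_enum.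
by rewrite uG => /matrixP/(_ 0 0); rewrite !mxE mulr1n.
Qed.

Lemma coord_locality_le (R : {set 'I_n}) :
  recovery_set C i R -> (coord_locality C i <= #|R|)%N.
Proof.
rewrite /coord_locality => hR; have := mem_index_enum R.
elim: (index_enum _) => // S s IHs; rewrite big_cons inE => /predU1P[<-|/IHs le_s].
  by rewrite hR geq_minl.
by case: ifP => // _; rewrite geq_min le_s orbT.
Qed.

End Locality.

(** * Roots of unity and character sums *)

Lemma sum_expr_unity (F : fieldType) n (z : F) :
  z ^+ n = 1 -> \sum_(t < n) z ^+ t = if z == 1 then n%:R else 0.
Proof.
move=> zn; case: eqP => [->|/eqP z1].
  by under eq_bigr do rewrite expr1n; rewrite sumr_const card_ord.
apply/eqP; move/eqP: zn; rewrite -subr_eq0 subrX1 mulf_eq0 subr_eq0.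
by rewrite (negbTE z1).
Qed.

Lemma finField_prim_root (F : finFieldType) n :
  (n %| #|F| - 1)%N -> exists z : F, n.-primitive_root z.
Proof.
have Fgt1 := finNzRing_gt1 F.
have : has (#|F| - 1).-primitive_root (enum (predC1 (0 : F))).
  apply: has_prim_root; rewrite ?subn_gt0 ?enum_uniq //; last first.
    by rewrite -cardE cardC1 subn1.
  apply/allP => x; rewrite mem_enum => x0; apply/unity_rootP/(mulfI x0).
  by rewrite -exprS mulr1 subn1 prednK ?expf_card // ltnW.
by case/hasP => z _ pz /(dvdn_prim_root pz) zn; eexists; exact: zn.
Qed.

Lemma primitive_root_neq0 (F : fieldType) n (z : F) :
  n.-primitive_root z -> z != 0.
Proof.
move=> pz; apply/eqP=> z0; have /eqP := prim_expr_order pz.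
by rewrite z0 expr0n eqn0Ngt (prim_order_gt0 pz) eq_sym oner_eq0.
Qed.

(* Summing [g] over the coset [z <w>] keeps the exponents divisible by [d];
   projecting [g] onto the [d]-th character of <z> keeps those congruent to [d]
   modulo [n]. *)
Lemma sum_cosets (F : fieldType) (n d : nat) (z w : F) (I : finType)
    (B : {set I}) (e : I -> nat) (c : I -> F) :
  n.-primitive_root z -> d.-primitive_root w ->
  (forall b, b \in B -> (d %| e b)%N = (e b == d %[mod n])) ->
  let g x := \sum_(b in B) c b * x ^+ e b in
  n%:R * \sum_(j < d) g (w ^+ j * z) =
  d%:R * z ^+ d * \sum_(t < n) (z ^- d) ^+ t * g (z ^+ t).
Proof.
move=> pz pw he g; have z0 := primitive_root_neq0 pz.
have -> : \sum_(j < d) g (w ^+ j * z) =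
    \sum_(b in B) c b * z ^+ e b * \sum_(j < d) (w ^+ e b) ^+ j.
  rewrite exchange_big /=; apply: eq_bigr => b _; rewrite mulr_sumr.
  by apply: eq_bigr => j _; rewrite exprMn (exprAC w) mulrCA mulrC.
have -> : \sum_(t < n) (z ^- d) ^+ t * g (z ^+ t) =
    \sum_(b in B) c b * \sum_(t < n) (z ^+ e b / z ^+ d) ^+ t.
  under eq_bigr do rewrite mulr_sumr.
  rewrite exchange_big /=; apply: eq_bigr => b _; rewrite mulr_sumr.
  by apply: eq_bigr => t _; rewrite exprMn (exprAC z) mulrCA [X in _ * X]mulrC.
(* Compare the terms of each [b]: both inner sums vanish unless [d] divides [e b], and then
   [z ^+ e b = z ^+ d]. *)
rewrite !mulr_sumr; apply: eq_bigr => b /he eb.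
have exp1 (u : F) k x : u ^+ k = 1 -> (u ^+ x) ^+ k = 1.
  by move=> uk; rewrite exprAC uk expr1n.
rewrite !sum_expr_unity ?(exp1 _ _ _ (prim_expr_order pw)) //; last first.
  by rewrite exprMn exprVn !(exp1 _ _ _ (prim_expr_order pz)) divr1.
rewrite -(prim_order_dvd pw) eb -(eq_prim_root_expr pz).
rewrite -[z ^+ e b / _ == 1](inj_eq (mulIf (expf_neq0 d z0))) divfK ?expf_neq0 // mul1r.
case: eqP => [->|_]; last by rewrite !mulr0.
by rewrite [RHS]mulrC [c b * n%:R]mulrC -[RHS]mulrA [d%:R * _]mulrC -!mulrA.
Qed.

(** * Scaling one coordinate of the evaluation points *)

Section Scaling.
Variables (F : finFieldType) (m : nat) (N : 'I_m -> nat) (J : {set 'I_m}).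
Variable h : 'I_m.
Hypotheses (hJ : h \in J) (N_gt1 : (1 < N h)%N).

Definition J_scale (P : {ffun 'I_m -> F}) (r : F) : {ffun 'I_m -> F} :=
  [ffun j => if j == h then r * P j else P j].

(** Meaningful when [r ^+ (N h - 1) = 1], since the scaled point is then still a zero; otherwise
    [enum_rank_in] may return a default index. *)
Definition J_shift (i : 'I_#|J_zeros F N J|) (r : F) : 'I_#|J_zeros F N J| :=
  enum_rank_in (enum_valP i) (J_scale (J_point i) r).

Lemma J_gen_eval (P : {ffun 'I_m -> F}) j :
  (J_gen F N J j).@[P] =
  if j \in J then P j ^+ (N j - 1) - 1 else P j ^+ N j - P j.
Proof.
by rewrite /J_gen; case: ifP; rewrite mevalB rmorphXn /= mevalXU ?meval1.
Qed.

Lemma J_point_unity (i : 'I_#|J_zeros F N J|) : J_point i h ^+ (N h - 1) = 1 :> F.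
Proof.
have := enum_valP i; rewrite inE => /forallP/(_ h).
by rewrite J_gen_eval hJ subr_eq0 => /eqP.
Qed.

Lemma J_shiftE (i : 'I_#|J_zeros F N J|) r : r ^+ (N h - 1) = 1 ->
  J_point (J_shift i r) = J_scale (J_point i) r.
Proof.
move=> r1; apply: enum_rankK_in; rewrite inE; apply/forallP => j.
have := enum_valP i; rewrite inE => /forallP/(_ j); rewrite !J_gen_eval ffunE.
by case: (j =P h) => // ->; rewrite hJ exprMn r1 mul1r.
Qed.

Lemma J_shift1 i : J_shift i 1 = i.
Proof.
rewrite -[RHS](enum_valK_in (enum_valP i)); congr enum_rank_in.
by apply/ffunP => j; rewrite ffunE mul1r if_same.
Qed.

Lemma J_shift_neq i r : r ^+ (N h - 1) = 1 -> r != 1 -> J_shift i r != i.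
Proof.
move=> rN; apply: contra_neq => /(congr1 (@J_point _ _ _ _)).
rewrite J_shiftE // => /ffunP/(_ h); rewrite ffunE eqxx => /eqP.
rewrite -subr_eq0 -{2}[J_point i h]mul1r -mulrBl mulf_eq0 subr_eq0.
case/predU1P => // /eqP P0; have /eqP := J_point_unity i.
by rewrite P0 expr0n subn_eq0 leqNgt N_gt1 eq_sym oner_eq0.
Qed.

(** Scaling by [r] multiplies the value of the monomial of [b] by [r ^+ b h]; its value at the
    original point is absorbed into [c b]. *)
Lemma affine_code_shift (B : {set J_exps N J}) i y :
  y \in affine_code F B ->
  exists c : J_exps N J -> F, forall r, r ^+ (N h - 1) = 1 ->
  y 0 (J_shift i r) = \sum_(b in B) c b * r ^+ b h.
Proof.
rewrite /affine_code => yB.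
have [c ->] : exists c : J_exps N J -> F,
    y = \sum_(b in B) c b *: J_ev N J 'X_[J_mnm b].
  have : y \in (\sum_(b in B) <[J_ev N J 'X_[J_mnm b]]>)%VS.
    by move: yB; rewrite span_def big_map big_enum.
  case/memv_sumP => f fP ->; pose P b c := f b = c *: J_ev N J 'X_[J_mnm b].
  have /fin_all_exists[c cP] b : exists k, b \in B -> P b k.
    case: (boolP (b \in B)) => [/fP/vlineP[k fk]|_]; last by exists 0.
    by exists k.
  by exists c; apply: eq_bigr => b /cP.
pose P := J_point i.
exists (fun b => c b * \prod_j P j ^+ b j) => r rN; rewrite summxE.
apply: eq_bigr => b _; rewrite !mxE J_shiftE // mevalX -mulrA; congr (_ * _).
rewrite (bigD1 h) //= [in RHS](bigD1 h) //= mnmE ffunE eqxx exprMn -mulrA mulrC.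
rewrite -/P; congr (_ * _ * _); apply: eq_bigr => j /negbTE jh.
by rewrite mnmE ffunE jh.
Qed.

Lemma cyclotomic_exponent q (b y : J_exps N J) :
  b \in cyclotomic_set q y -> exists k, b h = q ^ k * y h %[mod N h - 1].
Proof.
rewrite inE => /iter_findex <-; exists (findex (J_mulq q) y b).
have topE : (J_top N J h).+1 = (N h - 1)%N by rewrite /J_top hJ -subSn ?subSS.
elim: (findex _ _ _) => [|k IHk]; first by rewrite mul1n.
rewrite iterS J_mulqE // /J_mulq_coord hJ [X in (_ %% X)%N = _ %[mod _]]topE.
by rewrite modn_mod -modnMmr IHk modnMmr mulnA expnS.
Qed.

(** Used with [n = q - 1] and [d] the first coordinate of [a v]; the last hypothesis is all that is
    asked of the exponent set. *)
Lemma subfield_subcode_recovery (F0 : finFieldType) (iota : {rmorphism F0 -> F})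
    (B : {set J_exps N J}) (n d : nat) i :
  (N h - 1 %| #|F| - 1)%N -> (n %| N h - 1)%N -> (d %| N h - 1)%N ->
  (1 < d)%N -> coprime d n ->
  (forall b, b \in B -> (d %| b h)%N = (b h == d %[mod n])) ->
  exists2 R, recovery_set (subfield_subcode iota (affine_code F B)) i R
           & (#|R| <= n + (d - 1))%N.
Proof.
move=> NF nN dN d_gt1 co_dn hB.
have [z pz] := finField_prim_root (dvdn_trans nN NF).
have [w pw] := finField_prim_root (dvdn_trans dN NF).
have unityN k u : (k %| N h - 1)%N -> u ^+ k = 1 -> u ^+ (N h - 1) = 1 :> F.
  by case/dvdnP=> x -> u1; rewrite mulnC exprM u1 expr1n.
have zN t : (z ^+ t) ^+ (N h - 1) = 1.
  by rewrite exprAC (unityN n) ?expr1n // prim_expr_order.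
have wN t : (w ^+ t) ^+ (N h - 1) = 1.
  by rewrite exprAC (unityN d) ?expr1n // prim_expr_order.
have w1 : w ^+ (N h - 1) = 1 := unityN d w dN (prim_expr_order pw).
have wzN t : (w ^+ t * z) ^+ (N h - 1) = 1.
  by rewrite exprMn wN mul1r -[z]expr1 zN.
(* Recovery reduces to a statement on [g] over the large field, coordinate [i] being the value at
   [r = 1]. *)
have recP (R : {set 'I_#|J_zeros F N J|}) : i \notin R ->
    (forall c : J_exps N J -> F, let g r := \sum_(b in B) c b * r ^+ b h in
     (forall r, r ^+ (N h - 1) = 1 -> J_shift i r \in R -> g r = 0) -> g 1 = 0) ->
    recovery_set (subfield_subcode iota (affine_code F B)) i R.
  move=> iR hR; apply: recovery_set_vanishing iR _ => x.
  rewrite mem_subfield_subcode => /(affine_code_shift i)[c cP] x0.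
  apply/eqP; rewrite -(fmorph_eq0 iota) -[i]J_shift1.
  have := cP 1 (expr1n _ _); rewrite mxE => ->; apply/eqP/hR => r rN rR.
  by rewrite -cP // mxE x0 ?rmorph0.
have [n1|n_neq1] := eqVneq n 1%N.
  exists [set J_shift i w]; last by rewrite cards1 n1.
  apply: recP => [|c g g0].
    rewrite inE eq_sym J_shift_neq // -[w]expr1.
    by rewrite -(prim_order_dvd pw) dvdn1 neq_ltn d_gt1 orbT.
  rewrite -[RHS](g0 w) ?inE ?eqxx //; apply: eq_bigr => b /hB.
  rewrite n1 !modn1 eqxx expr1n => /dvdnP[k ->].
  by rewrite mulnC exprM (prim_expr_order pw) expr1n.
have n_gt0 := prim_order_gt0 pz.
have n_gt1 : (1 < n)%N by rewrite ltn_neqAle eq_sym n_neq1.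
(* The index [j = 0] is left out of [R2], since [z] already occurs in [R1]; the union has at most
   [n + d - 2] elements. *)
pose R1 := [set J_shift i (z ^+ (t : 'I_n)) | t in [set t : 'I_n | 0 < t]%N].
pose R2 := [set J_shift i (w ^+ (j : 'I_d) * z) | j in [set j : 'I_d | 0 < j]%N].
have cardR k : (0 < k)%N -> #|[set t : 'I_k | 0 < t]%N| = k.-1.
  case: k => // k _; transitivity #|predC1 (ord0 : 'I_k.+1)|.
    by apply: eq_card => t; rewrite !inE -lt0n.
  by rewrite cardC1 card_ord.
exists (R1 :|: R2); last first.
  apply: leq_trans (leq_card_setU _ _) _.
  apply: leq_add; apply: leq_trans (leq_imset_card _ _) _.
    by rewrite cardR ?leq_pred.
  by rewrite cardR ?subn1 // ltnW.
apply: recP => [|c g g0].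
  rewrite inE negb_or; apply/andP; split; apply/imsetP => -[t].
    rewrite inE => t_gt0 /esym/eqP; apply/negP/J_shift_neq; rewrite ?zN //.
    by rewrite -(prim_order_dvd pz) gtnNdvd.
  rewrite inE => t_gt0 /esym/eqP; apply/negP/J_shift_neq; rewrite ?wzN //.
  (* The [d]-th power of [w ^+ t * z = 1] is [z ^+ d = 1], so [n] would divide [d], against
     coprimality. *)
  apply/eqP => wz1; have /eqP : (w ^+ t * z) ^+ d = 1 by rewrite wz1 expr1n.
  rewrite exprMn exprAC (prim_expr_order pw) expr1n mul1r -(prim_order_dvd pz).
  by move=> nd; rewrite /coprime (gcdn_idPr nd) (negbTE n_neq1) in co_dn.
have gR1 (t : 'I_n) : (0 < t)%N -> g (z ^+ t) = 0.
  move=> t_gt0; apply: g0; rewrite ?zN // inE; apply/orP; left.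
  by apply/imsetP; exists t; rewrite ?inE.
have gR2 (j : 'I_d) : g (w ^+ j * z) = 0.
  have [j0|j_gt0] := posnP j; last first.
    apply: g0; rewrite ?wzN // inE; apply/orP; right.
    by apply/imsetP; exists j; rewrite ?inE.
  by rewrite j0 mul1r -[z]expr1 -[1%N]/(val (Ordinal n_gt1)) gR1.
have /= := sum_cosets c pz pw hB.
(* The left side vanishes, and on the right only the term [t = 0], a nonzero multiple of [g 1],
   survives. *)
rewrite big1 ?mulr0 => [/esym/eqP|j _]; last exact: gR2.
rewrite (bigD1 (Ordinal n_gt0)) //= [X in _ + X]big1 ?addr0 => [|t t0]; last first.
  rewrite (_ : \sum_(b in B) _ = 0) ?mulr0 //.
  by apply: gR1; rewrite lt0n.
have zd0 := expf_neq0 d (primitive_root_neq0 pz).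
rewrite mul1r !mulf_eq0 (negbTE zd0) (negbTE (prim_root_natf_neq0 pw)) /=.
by move/eqP.
Qed.

End Scaling.

Theorem theorem2p9
  (p s l : nat) (Fq FQ : finFieldType) (iota : {rmorphism Fq -> FQ})
  (q Q : nat) (m : nat) (N : 'I_m.+1 -> nat) (J L : {set 'I_m.+1})
  (a : 'I_(q - 1) -> J_exps N J) (v : 'I_(q - 1)) :
  prime p -> q = (p ^ s)%N -> Q = (p ^ l)%N -> (s %| l)%N ->
  #|Fq| = q -> #|FQ| = Q ->
  (forall j, (1 < N j)%N) ->
  (forall j, (N j - 1 %| Q - 1)%N) ->
  L = [set ord0] ->
  L \subset J ->
  (forall j, j \in L -> (q - 1 %| N j - 1)%N) ->
  (forall k, a k \in representatives N J q) ->
  (forall k k', k != k' -> a k ord0 <> a k' ord0 %[mod q - 1]) ->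
  (* The bound can fail when the first coordinate of a v is 1: Fq = F_2,
     FQ = F_4, one variable, N = 4, Delta = {1, 2} gives a [3, 2, 2] code,
     whose locality is 2 > q - 1. *)
  (1 < a v ord0)%N ->
  (a v ord0 %| N ord0 - 1)%N ->
  (forall k, k != v -> gcdn (a v ord0) (a k ord0) = 1%N) ->
  gcdn (a v ord0) (q - 1) = 1%N ->
  let Delta := \bigcup_(k < q - 1) cyclotomic_set q (a k) in
  let C := subfield_subcode iota (affine_code FQ Delta) in
  is_LRC C /\ (locality C <= q - 1 + (a v ord0 - 1))%N.
Proof.
move=> p_pr qE QE _ cardFq cardFQ N_gt1 NQ -> /subsetP LJ qN _ a_inj d_gt1 dN
  co_d co_dq Delta C; set d := a v ord0 in d_gt1 dN co_d co_dq *.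
have J0 : ord0 \in J by rewrite LJ ?inE.
have {}qN : (q - 1 %| N ord0 - 1)%N by rewrite qN ?inE.
have q_gt0 : (0 < q)%N by rewrite qE expn_gt0 prime_gt0.
have Q_gt1 : (1 < Q)%N by rewrite -cardFQ finNzRing_gt1.
(* [d] divides [Q - 1], hence is coprime to [Q], a positive power of [p]. *)
have co_dq1 : coprime d q.
  have : coprime d Q.
    apply: coprime_dvdl (dvdn_trans dN (NQ _)) _.
    by rewrite -{2}(subnK (ltnW Q_gt1)) addn1 coprimenS.
  rewrite QE coprime_pexpr; first by rewrite qE; apply: coprimeXr.
  by move: Q_gt1; rewrite QE; case: (l).
have qmod1 k : q ^ k = 1 %[mod q - 1].
  by rewrite -modnXm -{1}(subnK q_gt0) modnDl modnXm exp1n.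
(* For [b] in the orbit of [a k], multiplying by [q ^ e] affects neither divisibility by [d] nor the
   class modulo [q - 1], so both sides hold exactly when [k = v]. *)
have DeltaP b : b \in Delta -> (d %| b ord0)%N = (b ord0 == d %[mod q - 1]).
  case/bigcupP => k _ /(cyclotomic_exponent J0 (N_gt1 _))[e be].
  have modb r : (r %| N ord0 - 1)%N -> b ord0 = q ^ e * a k ord0 %[mod r].
    by move=> rN; rewrite -(modn_dvdm _ rN) be modn_dvdm.
  rewrite /dvdn (modb d dN) (modb _ qN) -[in RHS]modnMml qmod1 modnMml mul1n.
  rewrite -/(dvdn _ _) Gauss_dvdr ?coprimeXr //.
  have [->|kv] := eqVneq k v; first by rewrite dvdnn eqxx.
  rewrite (negbTE (introN eqP (a_inj _ _ kv))).
  by apply/gcdn_idPl; rewrite co_d // => d1; rewrite -d1 ltnn in d_gt1.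
have recC i : exists2 R, recovery_set C i R & (#|R| <= q - 1 + (d - 1))%N.
  apply: (subfield_subcode_recovery J0 (N_gt1 _)) => //; first by rewrite cardFQ.
  exact/eqP.
split=> [i|]; first by have [R] := recC i; exists R.
apply/bigmax_leqP => i _; have [R recR] := recC i.
exact: leq_trans (coord_locality_le recR).
Qed.
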